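(* Let $n\ge1$. The Friedman--Smith cone of a cover of type $FS_n$ is: (1) basic for $n\ge3$ and for $n=1$, and simplicial but not basic for $n=2$; (2) matroidal if and only if $n=1$; moreover, every proper face of a Friedman--Smith cone is matroidal; (3) contained in a cone of the perfect cone decomposition if and only if $n\neq2,3$; in fact, a Friedman--Smith cone is itself a cone of the perfect cone decomposition if and only if $n\neq2,3,4$.
   Context: Friedman--Smith cone. Let $\widetilde\Gamma$ be the graph with two vertices $\tilde v_1,\tilde v_2$ and $2n$ edges $\tilde e_1^\pm,\dots,\tilde e_n^\pm$, all oriented from $\tilde v_1$ to $\tilde v_2$, with involution $\iota$ fixing $\tilde v_1,\tilde v_2$ and interchanging $\tilde e_i^+$ and $\tilde e_i^-$ for each $i$. (This is the dual graph of a Friedman--Smith cover with $2n$ nodes: an admissible double cover $\widetilde C\to C$ of stable curves with $\widetilde C=\widetilde C_1\cup\widetilde C_2$, the $\widetilde C_i$ smooth irreducible and preserved by the covering involution, meeting in $2n$ points that are interchanged pairwise.) Let $\Lambda=H_1(\widetilde\Gamma,\mathbb{Z})^{[-]}:=H_1(\widetilde\Gamma,\mathbb{Z})/H_1(\widetilde\Gamma,\mathbb{Z})^+$ (a lattice of rank $n$), where $^+$ denotes the $\iota$-invariants, so that $\Lambda^\vee=H^1(\widetilde\Gamma,\mathbb{Z})^-$, the $\iota$-anti-invariants. Let $\ell_i\in\Lambda^\vee$ be the class of $(\tilde e_i^+)^\vee-(\tilde e_i^-)^\vee$ if $n\ge2$, and $\ell_1=(\tilde e_1^+)^\vee$ if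 $n=1$. The Friedman--Smith cone (closed monodromy cone of an $FS_n$ cover) is $\mathbb{R}_{\ge0}\langle\ell_1^2,\dots,\ell_n^2\rangle\subset(\mathrm{Sym}^2\Lambda)^\vee_{\mathbb{R}}$. For $n\ge2$, in a suitable basis $x_1,\dots,x_n$ of $\Lambda^\vee$ it is $\mathbb{R}_{\ge0}\langle(2x_1-x_2-\dots-x_n)^2,x_2^2,\dots,x_n^2\rangle$; for $n=1$ it is $\mathbb{R}_{\ge0}\langle x_1^2\rangle$. Terminology. $(\mathrm{Sym}^2\Lambda)^\vee$ is the lattice of integral symmetric bilinear forms on $\Lambda$; $(\mathrm{Sym}^2\Lambda)^\vee_{\mathbb{R}}$ is the space of quadratic forms. A rational polyhedral cone in it is basic if the primitive integral generators of its one-dimensional faces can be completed to a $\mathbb{Z}$-basis of $(\mathrm{Sym}^2\Lambda)^\vee$, and simplicial if these generators are linearly independent. A cone is matroidal if it is a cone of the second Voronoi decomposition generated by rank $1$ quadrics; equivalently, it is of the form $\mathbb{R}_{\ge0}\langle m_1^2,\dots,m_k^2\rangle$ with $m_i\in\Lambda^\vee$ primitive and such that every $\mathbb{R}$-linearly independent subset $\{m_j\}_{j\in J}$ is a $\mathbb{Z}$-basis of $\mathbb{R}\langle m_j\rangle_{j\in J}\cap\Lambda^\vee$. The perfect cone decomposition consists of the cones $\mathbb{R}_{\ge0}\langle\ell^2:\ell\in\Lambda^\vee,\ Q(\ell)=1\rangle$ and their faces, for $Q$ a positive definite quadratic form on $\Lambda^\vee_{\mathbb{R}}$ with $Q\ge1$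 on $\Lambda^\vee\setminus\{0\}$. *)

(* Defs.v *)
From HB Require Import structures.
From mathcomp Require Import all_boot all_order all_algebra.
From mathcomp Require Import boolp classical_sets functions reals.
From mathcomp Require Import zify.

Set Implicit Arguments.
Unset Strict Implicit.
Unset Printing Implicit Defensive.

Import Order.TTheory GRing.Theory Num.Theory.
Local Open Scope classical_set_scope.
Local Open Scope ring_scope.

(* The involution preserves the orientation of the edges, so that it acts on
   1-chains by permuting the edges, without signs. *)
Record igraph := IGraph {
  vertex : finType;
  edge : finType;
  src : edge -> vertex;
  tgt : edge -> vertex;
  vinv : vertex -> vertex;
  einv : edge -> edge;
  vinvK : involutive vinv;
  einvK : involutive einv;
  src_einv : forall e, src (einv e) = vinv (src e);
  tgt_einv : forall e, tgt (einv e) = vinv (tgt e) }.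

Notation chain0 G := {ffun vertex G -> int}.
Notation chain1 G := {ffun edge G -> int}.

Definition boundary (G : igraph) (a : chain1 G) : chain0 G :=
  [ffun v => \sum_(e | tgt e == v) a e - \sum_(e | src e == v) a e].

Definition is_cycle (G : igraph) : {pred chain1 G} :=
  fun a => boundary a == 0.

Lemma is_cycle_zmod_closed G : zmod_closed (@is_cycle G).
Proof.
split=> [|a b /eqP a0 /eqP b0].
  by apply/eqP/ffunP => v; rewrite !ffunE !big1 ?subrr// => e _; rewrite ffunE.
have bB : boundary (a - b) = boundary a - boundary b.
  apply/ffunP => v.
  have sumB (P : pred (edge G)) :
      \sum_(e | P e) (a - b) e = \sum_(e | P e) a e - \sum_(e | P e) b e.
    by rewrite -sumrB; apply: eq_bigr => e _; rewrite !ffunE.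
  rewrite ffunE !sumB !ffunE !opprB addrACA [RHS]addrACA.
  by congr (_ + _); exact: addrC.
by apply/eqP; rewrite bB a0 b0 subr0.
Qed.

HB.instance Definition _ G :=
  GRing.isZmodClosed.Build (chain1 G) (@is_cycle G) (@is_cycle_zmod_closed G).

Record H1 (G : igraph) := Cycle {
  cycle_val :> chain1 G;
  _ : cycle_val \in @is_cycle G }.
HB.instance Definition _ G := [isSub for @cycle_val G].
HB.instance Definition _ G := [Choice of H1 G by <:].
HB.instance Definition _ G := [SubChoice_isSubZmodule of H1 G by <:].

Definition H1_inv (G : igraph) : {pred H1 G} :=
  fun a => [forall e, a (einv e) == a e].

Lemma H1_inv_zmod_closed G : zmod_closed (@H1_inv G).
Proof.
split=> [|a b /forallP ai /forallP bi]; apply/forallP => e.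
  by rewrite !ffunE.
by rewrite !ffunE (eqP (ai e)) (eqP (bi e)).
Qed.

HB.instance Definition _ G :=
  GRing.isZmodClosed.Build (H1 G) (@H1_inv G) (@H1_inv_zmod_closed G).

Definition H1_minus (G : igraph) := Quotient.quot (@H1_inv G).
HB.instance Definition _ G := GRing.Zmodule.on (H1_minus G).

Definition pairing (G : igraph) (c : chain1 G) (a : H1 G) : int :=
  \sum_e c e * a e.

(* [dualR R L] is Hom(L, R), which is the scalar extension of the dual lattice
   Hom(L, Z) when L is free of finite rank; the dual lattice sits in it as the
   integer-valued functionals [dualZ R L].  Likewise for [symR] and [symZ]. *)
Definition is_dual (R : realType) (L : zmodType) : {pred L -> R^o} :=
  fun f => `[< zmod_morphism f >].

Lemma is_dual_submod_closed R L : submod_closed (@is_dual R L).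
Proof.
split=> [|k f g /asboolP fB /asboolP gB]; apply/asboolP => x y.
  by rewrite /= subrr.
by rewrite !fctE fB gB scalerBr opprD addrACA.
Qed.

HB.instance Definition _ (R : realType) (L : zmodType) :=
  GRing.isSubmodClosed.Build R (L -> R^o) (@is_dual R L)
    (@is_dual_submod_closed R L).

Record dualR (R : realType) (L : zmodType) := DualR {
  dual_fun :> L -> R^o;
  _ : dual_fun \in @is_dual R L }.
HB.instance Definition _ R L := [isSub for @dual_fun R L].
HB.instance Definition _ R L := [Choice of dualR R L by <:].
HB.instance Definition _ (R : realType) (L : zmodType) :=
  [SubChoice_isSubLmodule of dualR R L by <:].

Definition dualZ (R : realType) (L : zmodType) : set (dualR R L) :=
  [set f | forall x, f x \is a Num.int].

Definition is_symform (R : realType) (L : zmodType) : {pred L -> L -> R^o} :=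
  fun b => `[< (forall x, zmod_morphism (b x)) /\ (forall x y, b x y = b y x) >].

Lemma is_symform_submod_closed R L : submod_closed (@is_symform R L).
Proof.
split=> [|k f g /asboolP[fB fC] /asboolP[gB gC]]; apply/asboolP.
  by split=> // x y z; rewrite /= subrr.
split=> [x y z|x y]; first by rewrite !fctE fB gB scalerBr opprD addrACA.
by rewrite !fctE fC gC.
Qed.

HB.instance Definition _ (R : realType) (L : zmodType) :=
  GRing.isSubmodClosed.Build R (L -> L -> R^o) (@is_symform R L)
    (@is_symform_submod_closed R L).

Record symR (R : realType) (L : zmodType) := SymR {
  symform_fun :> L -> L -> R^o;
  _ : symform_fun \in @is_symform R L }.
HB.instance Definition _ R L := [isSub for @symform_fun R L].
HB.instance Definition _ R L := [Choice of symR R L by <:].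
HB.instance Definition _ (R : realType) (L : zmodType) :=
  [SubChoice_isSubLmodule of symR R L by <:].

Definition symZ (R : realType) (L : zmodType) : set (symR R L) :=
  [set b | forall x y, b x y \is a Num.int].

Lemma sq_subproof R L (m : dualR R L) :
  (fun x y => m x * m y) \in @is_symform R L.
Proof.
case: m => f /= /asboolP fB; apply/asboolP; split=> [x y z|x y].
  by rewrite fB mulrBr.
by rewrite mulrC.
Qed.

Definition sq (R : realType) (L : zmodType) (m : dualR R L) : symR R L :=
  SymR (sq_subproof m).

Definition lin_indep (R : realType) (V : lmodType R) k (m : 'I_k -> V) :=
  forall c : 'I_k -> R, \sum_i c i *: m i = 0 -> forall i, c i = 0.

Definition rspan (R : realType) (V : lmodType R) k (m : 'I_k -> V) : set V :=
  [set v | exists c : 'I_k -> R, v = \sum_i c i *: m i].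

Definition zbasis (V : zmodType) (L : set V) k (m : 'I_k -> V) :=
  [/\ forall i, L (m i),
      forall c : 'I_k -> int, \sum_i m i *~ c i = 0 -> forall i, c i = 0 &
      forall v, L v -> exists c : 'I_k -> int, v = \sum_i m i *~ c i].

Definition primitive (V : zmodType) (L : set V) (v : V) :=
  [/\ L v, v <> 0 & forall (k : nat) w, L w -> v = w *+ k -> k = 1%N].

Definition cone (R : realType) (V : lmodType R) (G : set V) : set V :=
  [set v | exists k (g : 'I_k -> V) (c : 'I_k -> R),
     [/\ forall i, G (g i), forall i, 0 <= c i & v = \sum_i c i *: g i]].

Definition face (R : realType) (V : lmodType R) (tau sigma : set V) :=
  exists2 phi : {scalar V}, forall v, sigma v -> 0 <= phi v &
    tau = [set v | sigma v /\ phi v = 0].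

Definition proper_face (R : realType) (V : lmodType R) (tau sigma : set V) :=
  face tau sigma /\ tau <> sigma.

Definition rational_polyhedral (R : realType) (V : lmodType R)
    (L : set V) (sigma : set V) :=
  exists k (g : 'I_k -> V), (forall i, L (g i)) /\ sigma = cone (range g).

Definition ray_gen (R : realType) (V : lmodType R) (L sigma : set V) (v : V) :=
  primitive L v /\ face (cone [set v]) sigma.

Definition basic (R : realType) (V : lmodType R) (L sigma : set V) :=
  rational_polyhedral L sigma /\
  exists k (b : 'I_k -> V),
    zbasis L b /\ forall v, ray_gen L sigma v -> range b v.

Definition simplicial (R : realType) (V : lmodType R) (L sigma : set V) :=
  rational_polyhedral L sigma /\
  forall k (m : 'I_k -> V), injective m ->
    (forall i, ray_gen L sigma (m i)) -> lin_indep m.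

(* These are the cones of the second Voronoi decomposition that are generated by
   rank one forms (Erdahl--Ryshkov).  The injection [s] picks out a subset of the [m i]. *)
Definition matroidal (R : realType) (L : zmodType) (sigma : set (symR R L)) :=
  exists k (m : 'I_k -> dualR R L),
    [/\ forall i, primitive (@dualZ R L) (m i),
        sigma = cone (range (fun i => sq (m i))) &
        forall r (s : 'I_r -> 'I_k), injective s -> lin_indep (m \o s) ->
          zbasis (rspan (m \o s) `&` @dualZ R L) (m \o s)].

(* [Q : {dot _ for idfun}] is a positive definite symmetric bilinear form; the
   associated quadratic form is [fun m => Q m m]. *)
Definition perfect_cone (R : realType) (L : zmodType)
    (sigma : set (symR R L)) :=
  exists2 Q : {dot (dualR R L) for idfun},
    forall m, dualZ m -> m <> 0 -> 1 <= Q m m &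
    face sigma (cone [set sq m | m in [set m | dualZ m /\ Q m m = 1]]).

Definition FS_vertex : finType := bool.
Definition FS_edge (n : nat) : finType := ('I_n * bool)%type.

(* The edge [(i, true)] is e_i^+ and [(i, false)] is e_i^-; the two vertices are
   [false] and [true]. *)
Definition FS_graph (n : nat) : igraph :=
  @IGraph FS_vertex (FS_edge n) (fun _ => false) (fun _ => true)
    id (fun e => (e.1, ~~ e.2))
    (fun _ => erefl)
    (fun e => let: (i, b) := e in congr1 (pair i) (negbK b))
    (fun _ => erefl) (fun _ => erefl).

Definition FS_lattice (n : nat) : zmodType := H1_minus (FS_graph n).

Definition dual_edge n (e : FS_edge n) : chain1 (FS_graph n) :=
  [ffun e' => (e' == e)%:R].

(* For n = 1, the class of e_1^+ is already anti-invariant, and that of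
   e_1^+ - e_1^- is twice it. *)
Definition ell_cochain n (i : 'I_n) : chain1 (FS_graph n) :=
  if n == 1%N then dual_edge (i, true)
  else dual_edge (i, true) - dual_edge (i, false).

Lemma pairingB G (c : chain1 G) (a b : H1 G) :
  pairing c (a - b) = pairing c a - pairing c b.
Proof.
by rewrite /pairing -sumrB; apply: eq_bigr => e _; rewrite !ffunE mulrBr.
Qed.

Lemma pairing_dual_edge n (e : FS_edge n) (a : H1 (FS_graph n)) :
  pairing (dual_edge e) a = a e.
Proof.
rewrite /pairing (bigD1 e)//= !ffunE eqxx mul1r big1 ?addr0// => e' /negPf ne.
by rewrite ffunE ne mul0r.
Qed.

Lemma pairingBl G (c d : chain1 G) (a : H1 G) :
  pairing (c - d) a = pairing c a - pairing d a.
Proof.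
by rewrite /pairing -sumrB; apply: eq_bigr => e _; rewrite !ffunE mulrBl.
Qed.

Lemma ell_cochain_inv n (i : 'I_n) (a : H1 (FS_graph n)) :
  a \in @H1_inv (FS_graph n) -> pairing (ell_cochain i) a = 0.
Proof.
move=> /forallP/(_ (i, true))/= /eqP ai.
rewrite /ell_cochain; case: eqP => [n1|_]; last first.
  by rewrite pairingBl !pairing_dual_edge ai subrr.
rewrite pairing_dual_edge; subst n.
have /eqP/ffunP/(_ true) := valP a.
rewrite !ffunE [X in _ - X]big_pred0// subr0 (bigD1 (i, true))//=.
rewrite (bigD1 (i, false)) ?xpair_eqE ?andbF//= big1; first by rewrite ai; lia.
by move=> [j []]; rewrite (ord1 i) (ord1 j).
Qed.

Lemma pairing_repr G (c : chain1 G) (a : H1 G) :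
  (forall b, b \in @H1_inv G -> pairing c b = 0) ->
  pairing c (repr (\pi_(H1_minus G) a)%qT) = pairing c a.
Proof.
move=> c0; apply/eqP; rewrite -subr_eq0 -pairingB; apply/eqP/c0.
have := Quotient.idealrBE (@H1_inv G) (repr (\pi_(H1_minus G) a)%qT) a.
by rewrite reprK eqxx.
Qed.

(* The element of the dual lattice represented by [ell_cochain i]: it maps the
   class of a cycle [a] to [pairing (ell_cochain i) a]. *)
Definition ell_fun (R : realType) n (i : 'I_n) : FS_lattice n -> R^o :=
  fun x => (pairing (ell_cochain i) (repr x))%:~R.

Lemma ell_subproof R n (i : 'I_n) :
  @ell_fun R n i \in @is_dual R (FS_lattice n).
Proof.
apply/asboolP => x y; rewrite /ell_fun -rmorphB /= -pairingB.
rewrite -{1}[x]reprK -{1}[y]reprK -raddfB pairing_repr//.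
exact: ell_cochain_inv.
Qed.

Definition ell (R : realType) n (i : 'I_n) : dualR R (FS_lattice n) :=
  DualR (ell_subproof R i).

Definition FS_cone (R : realType) (n : nat) : set (symR R (FS_lattice n)) :=
  cone (range (fun i : 'I_n => sq (ell R i))).
Arguments FS_cone R n : clear implicits.

(* Main.v *)
Require Import Defs.
From HB Require Import structures.
From mathcomp Require Import all_boot all_order all_algebra.
From mathcomp Require Import boolp classical_sets reals.
From mathcomp Require Import zify ring lra.

(** Writing [d_i = a(e_i^+) - a(e_i^-)] for a cycle [a] identifies the lattice with
    [D_n = {d in Z^n | sum_i d_i even}] for [n >= 2], with dual lattice
    [Z^n + Z h], [h = (1/2, ..., 1/2)], in which the [ell_i] are the unit vectors.

    A decomposition of [ell_i^2] into squares only involves multiples of [ell_i], so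
    every family of squares spanning the cone contains all [ell_i^2].  As
    [h = (ell_1 + ... + ell_n) / 2] is integral, the [ell_i] are not a Z-basis,
    whereas any proper subfamily generates a saturated sublattice; this gives the
    statements on matroidal cones.  In the basis of integral forms coming from the
    basis [h, ell_2, ..., ell_n] of the dual lattice,
    [ell_1^2 = (2h - ell_2 - ... - ell_n)^2] has coefficient 1 on [ell_2 ell_3] if
    [n >= 3], while [ell_1^2 - ell_2^2] is divisible by 2 if [n = 2].

    If a perfect cone of [Q] contains the Friedman--Smith cone, then [Q(ell_i) = 1], and the
    average of [Q] over the integral vectors [(+-ell_1 ... +-ell_n) / 2] is [n/4], so
    that [n >= 4] unless [n = 1]; for [n = 4] all these vectors are minimal, and the sum of
    their squares is a multiple of [sum_i ell_i^2].  Conversely, the standard form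
    works if [n = 1] or [n >= 4], with no other minimal vectors than
    the [+-ell_i] unless [n = 4]. *)

Set Implicit Arguments.
Unset Strict Implicit.
Unset Printing Implicit Defensive.

Import Order.TTheory GRing.Theory Num.Theory.
Local Open Scope classical_set_scope.
Local Open Scope ring_scope.

(** * Evaluation of functionals and of symmetric forms *)

Section Evaluation.
Variables (R : realType) (L : zmodType).
Implicit Types (f g : dualR R L) (b : symR R L).

Lemma dual_is_additive f : zmod_morphism (f : L -> R).
Proof. by case: f => f /= /asboolP. Qed.
HB.instance Definition _ f :=
  GRing.isZmodMorphism.Build L R (f : L -> R) (dual_is_additive f).

Lemma symform_is_additive b x : zmod_morphism (b x : L -> R).
Proof. by case: b => b /= /asboolP[+ _]; exact. Qed.
HB.instance Definition _ b x :=
  GRing.isZmodMorphism.Build L R (b x : L -> R) (symform_is_additive b x).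

Lemma dualB f x y : f (x - y) = f x - f y :> R. Proof. exact: raddfB. Qed.
Lemma dualD f x y : f (x + y) = f x + f y :> R. Proof. exact: raddfD. Qed.
Lemma dualMn f x k : f (x *+ k) = f x *+ k :> R. Proof. exact: raddfMn. Qed.
Lemma dualMz f x (z : int) : f (x *~ z) = f x * z%:~R :> R.
Proof. by rewrite mulrzr; exact: raddfMz. Qed.
Lemma dual_sum f (I : Type) (r : seq I) (P : pred I) (F : I -> L) :
  f (\sum_(i <- r | P i) F i) = \sum_(i <- r | P i) f (F i) :> R.
Proof. exact: raddf_sum. Qed.

Lemma symformD b x y z : b x (y + z) = b x y + b x z :> R. Proof. exact: raddfD. Qed.
Lemma symformMn b x y k : b x (y *+ k) = b x y *+ k :> R. Proof. exact: raddfMn. Qed.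
Lemma symformMz b x y (z : int) : b x (y *~ z) = b x y * z%:~R :> R.
Proof. by rewrite mulrzr; exact: raddfMz. Qed.
Lemma symform_sum b x (I : Type) (r : seq I) (P : pred I) (F : I -> L) :
  b x (\sum_(i <- r | P i) F i) = \sum_(i <- r | P i) b x (F i) :> R.
Proof. exact: raddf_sum. Qed.

Lemma symformC b x y : b x y = b y x.
Proof. by case: b => b /= /asboolP[_]; exact. Qed.

Definition dual_ev x f : R := f x.
Lemma dual_ev_is_scalar x : scalar (dual_ev x).
Proof. by []. Qed.
HB.instance Definition _ x :=
  GRing.isLinear.Build R (dualR R L) R *%R (dual_ev x) (dual_ev_is_scalar x).

Definition form_ev x y b : R := b x y.
Lemma form_ev_is_scalar x y : scalar (form_ev x y).
Proof. by []. Qed.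
HB.instance Definition _ x y :=
  GRing.isLinear.Build R (symR R L) R *%R (form_ev x y) (form_ev_is_scalar x y).

Lemma dualP f g : (forall x, f x = g x) -> f = g.
Proof. by move=> fg; apply/val_inj/funext. Qed.

Lemma symformP b (c : symR R L) : (forall x y, b x y = c x y) -> b = c.
Proof. by move=> bc; apply: val_inj; apply: funext => x; apply: funext => y; exact: bc. Qed.

Lemma dual_sumE (I : Type) (r : seq I) (P : pred I) (F : I -> dualR R L) x :
  (\sum_(i <- r | P i) F i) x = \sum_(i <- r | P i) F i x :> R.
Proof. exact: (raddf_sum (dual_ev x)). Qed.

Lemma symform_sumE (I : Type) (r : seq I) (P : pred I) (F : I -> symR R L) x y :
  (\sum_(i <- r | P i) F i) x y = \sum_(i <- r | P i) F i x y :> R.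
Proof. exact: (raddf_sum (form_ev x y)). Qed.

Lemma dual_scaleE (a : R) f x : (a *: f) x = a * f x :> R. Proof. by []. Qed.
Lemma symform_scaleE (a : R) b x y : (a *: b) x y = a * b x y :> R.
Proof. by []. Qed.
Lemma dualBE f (g : dualR R L) x : (f - g) x = f x - g x :> R. Proof. by []. Qed.
Lemma dualDE f (g : dualR R L) x : (f + g) x = f x + g x :> R. Proof. by []. Qed.
Lemma dual_mulzE f (z : int) x : (f *~ z) x = f x * z%:~R :> R.
Proof. by rewrite -[LHS]/(dual_ev x (f *~ z)) raddfMz -mulrzr. Qed.
Lemma symformDE b (c : symR R L) x y : (b + c) x y = b x y + c x y :> R.
Proof. by []. Qed.
Lemma symformBE b (c : symR R L) x y : (b - c) x y = b x y - c x y :> R.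
Proof. by []. Qed.

Lemma symform_lincombE k (m : 'I_k -> symR R L) (c : 'I_k -> R) x y :
  (\sum_i c i *: m i) x y = \sum_i c i * m i x y :> R.
Proof. exact: symform_sumE. Qed.

Lemma sqE f x y : sq f x y = f x * f y :> R. Proof. by []. Qed.
Lemma sqZ (a : R) f : sq (a *: f) = a ^+ 2 *: sq f.
Proof. by apply: symformP => x y; rewrite symform_scaleE !sqE !dual_scaleE; ring. Qed.

End Evaluation.

(** * The lattice in the coordinates [d_i] *)

Section Lattice.
Variable n : nat.
Local Notation G := (FS_graph n).
Local Notation L := (FS_lattice n).

(** All edges run from one vertex to the other, so the boundary at either vertex is the total sum up
    to sign. *)
Lemma is_cycleE (a : chain1 G) : (a \in @is_cycle G) = (\sum_e a e == 0).
Proof.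
have sE v : boundary a v = (if v then 1 else -1) * \sum_e a e.
  rewrite ffunE; case: v; rewrite /=.
    by rewrite mul1r [X in _ - X]big_pred0// subr0; apply: eq_bigl => e.
  by rewrite mulN1r big_pred0// sub0r; congr (- _); apply: eq_bigl => e.
apply/eqP/eqP => [/ffunP/(_ true)|a0]; first by rewrite sE ffunE mul1r.
by apply/ffunP => v; rewrite sE a0 mulr0 ffunE.
Qed.

Lemma sum_cycle (a : H1 G) : \sum_i (a (i, true) + a (i, false)) = 0.
Proof.
have := valP a; rewrite is_cycleE => /eqP a0; rewrite -[RHS]a0.
rewrite [RHS](eq_bigr (fun e : 'I_n * bool => (cycle_val a) (e.1, e.2))); last by case.
rewrite -(pair_bigA _ (fun i b => (cycle_val a) (i, b)))/=.
by apply: eq_bigr => i _; rewrite big_bool.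
Qed.

Lemma sum_dual_edge (e : FS_edge n) : \sum_e' dual_edge e e' = 1.
Proof.
rewrite (bigD1 e)//= ffunE eqxx big1 ?addr0// => e' /negPf ne.
by rewrite ffunE ne.
Qed.

Lemma path_cycle_subproof (i j : 'I_n) :
  (dual_edge (i, true) - dual_edge (j, false)) \in @is_cycle G.
Proof.
rewrite is_cycleE; apply/eqP.
transitivity (\sum_e dual_edge (i, true) e - \sum_e dual_edge (j, false) e).
  by rewrite -sumrB; apply: eq_bigr => e _; rewrite !ffunE.
by rewrite !sum_dual_edge subrr.
Qed.

(* In the coordinates [lat_coord], [latw i j] is [e_i + e_j] and [latu i] is [2 e_i]. *)
Definition latw (i j : 'I_n) : L :=
  (\pi_(H1_minus G) (Cycle (path_cycle_subproof i j)))%qT.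

(** This is the coordinate [d_i]. It is read off a representative; invariant cycles have [d_i = 0],
    so the choice does not matter. *)
Definition lat_coord (i : 'I_n) (x : L) : int :=
  (repr x : H1 G) (i, true) - (repr x : H1 G) (i, false).

Lemma lat_coord_pi i (a : H1 G) :
  lat_coord i (\pi_(H1_minus G) a)%qT = a (i, true) - a (i, false).
Proof.
rewrite /lat_coord -!pairing_dual_edge -!pairingBl pairing_repr// => b.
move=> /forallP/(_ (i, true))/= /eqP bi.
by rewrite pairingBl !pairing_dual_edge bi subrr.
Qed.

Lemma lat_coordB i : zmod_morphism (lat_coord i).
Proof.
move=> x y; rewrite -[x]reprK -[y]reprK -raddfB !lat_coord_pi !ffunE /=.
ring.
Qed.
HB.instance Definition _ i := GRing.isZmodMorphism.Build L int (lat_coord i) (lat_coordB i).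

Lemma lat_coord_latw k i j : lat_coord k (latw i j) = (k == i)%:R + (k == j)%:R.
Proof.
rewrite lat_coord_pi/= !ffunE !xpair_eqE/= !andbT !andbF.
by case: (k == i); case: (k == j).
Qed.

(** If all [d_i] vanish, the representative takes equal values on [e_i^+] and [e_i^-], so it is
    invariant and its class is zero. *)
Lemma lat_coord_inj x : (forall i, lat_coord i x = 0) -> x = 0.
Proof.
move=> x0; rewrite -[x]reprK -[RHS](raddf0 (\pi_(H1_minus G))%qT).
apply/eqP; rewrite -Quotient.idealrBE subr0; apply/forallP => -[i b].
have /eqP := x0 i; rewrite /lat_coord subr_eq0 => /eqP xi.
by case: b; rewrite /= xi.
Qed.

(** The values of a cycle sum to zero, whence [sum_i d_i = -2 sum_i a(e_i^-)]. *)
Lemma lat_coord_even x : exists k : int, \sum_i lat_coord i x = k *+ 2.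
Proof.
exists (- \sum_i (repr x : H1 G) (i, false)).
have /eqP := sum_cycle (repr x).
by rewrite !big_split/= sumrN addr_eq0 => /eqP ->; rewrite mulr2n.
Qed.

Definition latu i : L := latw i i.

Lemma latw_double i j : latw i j *+ 2 = latu i + latu j.
Proof.
apply/eqP; rewrite -subr_eq0; apply/eqP/lat_coord_inj => k.
rewrite (raddfB (lat_coord k)) (raddfMn (lat_coord k))
  (raddfD (lat_coord k))/= /latu !lat_coord_latw.
by case: (k == i); case: (k == j).
Qed.

(** Since [R] has no torsion, this makes the [latu i] sufficient for testing real-valued functionals
    and forms. *)
Lemma lat_double x : x *+ 2 = \sum_i latu i *~ lat_coord i x.
Proof.
apply/eqP; rewrite -subr_eq0; apply/eqP/lat_coord_inj => k.
rewrite (raddfB (lat_coord k)) (raddfMn (lat_coord k))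
  (raddf_sum (lat_coord k))/= /latu (bigD1 k)//= big1 => [|i /negPf ik].
  rewrite (raddfMz (lat_coord k))/= lat_coord_latw eqxx addr0 -mulrzr intz.
  by rewrite -mulr2n mulr_natl subrr.
by rewrite (raddfMz (lat_coord k))/= lat_coord_latw eq_sym ik mul0rz.
Qed.

End Lattice.

(** * The functionals [ell_i] and the extremality of their squares *)

Section Ell.
Variables (R : realType) (n : nat).
Local Notation L := (FS_lattice n).
Local Notation l := (@ell R n).
Implicit Types (f : dualR R L) (b : symR R L) (x y : L).

(* The value of [ell_i] on [latu i]: for n = 1 the lattice is generated by [latu i]. *)
Definition ell_scale : R := if n == 1%N then 1 else 2.

Lemma ell_scale_neq0 : ell_scale != 0.
Proof. by rewrite /ell_scale; case: ifP => _; rewrite ?oner_neq0 ?pnatr_eq0. Qed.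

Lemma ell_coord i x : n != 1%N -> l i x = (lat_coord i x)%:~R.
Proof.
by move=> /negPf n1; rewrite /= /ell_fun /ell_cochain n1 pairingBl !pairing_dual_edge.
Qed.

(** For [n = 1] a cycle has [a(e_1^+) = -a(e_1^-)], so [d_1 = 2 a(e_1^+)]; the factor 2 on the left
    lets one formula cover all [n]. *)
Lemma ell_double i x : 2 * l i x = ell_scale * (lat_coord i x)%:~R :> R.
Proof.
case: (eqVneq n 1%N) => [n1|n1]; last by rewrite ell_coord// /ell_scale (negPf n1).
have n1b : (n == 1%N) = true by apply/eqP.
rewrite /ell_scale n1b mul1r /= /ell_fun /ell_cochain n1b pairing_dual_edge.
rewrite -[2]/(2%:~R) -intrM; congr (_%:~R).
move: (sum_cycle (repr x)); rewrite (bigD1 i)//= big1 ?addr0 => [|j /eqP]; last first.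
  by case; apply: val_inj => /=; move: (ltn_ord i) (ltn_ord j); lia.
by move=> /eqP; rewrite addr_eq0 /lat_coord => /eqP ->; ring.
Qed.

Lemma ell_int i x : l i x \is a Num.int.
Proof. exact: intr_int. Qed.

Lemma ell_latu i j : l i (latu j) = ell_scale * (i == j)%:R.
Proof.
apply: (@mulfI _ 2); first by rewrite pnatr_eq0.
by rewrite ell_double lat_coord_latw; case: (i == j) => //=; ring.
Qed.

Lemma ell_latw k i j : n != 1%N -> l k (latw i j) = (k == i)%:R + (k == j)%:R :> R.
Proof. by move=> n1; rewrite ell_coord// lat_coord_latw rmorphD/= !natz. Qed.

Lemma ell_eq1 i : exists x, l i x = 1.
Proof.
case: (eqVneq n 1%N) => [n1|n1].
  by exists (latu i); rewrite ell_latu eqxx mulr1 /ell_scale (introT eqP n1).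
(* For [n >= 2] the value on [latu i] is 2, so a second index is needed: [e_i + e_j] gives the value
   1. *)
have [j ji] : exists j : 'I_n, j != i.
  have n2 : (1 < n)%N by move: (ltn_ord i); lia.
  case: (eqVneq (nat_of_ord i) 0%N) => i0.
    by exists (Ordinal n2); rewrite -val_eqE/= i0.
  by exists (Ordinal (ltnW n2)); rewrite -val_eqE/= eq_sym.
by exists (latw i j); rewrite ell_latw// eqxx eq_sym (negPf ji) addr0.
Qed.

Lemma dual_decomp f : f = \sum_i (f (latu i) / ell_scale) *: l i.
Proof.
apply: dualP => x; rewrite dual_sumE.
apply: (@mulfI _ 2); first by rewrite pnatr_eq0.
have -> : 2 * f x = f (x *+ 2) :> R by rewrite dualMn mulr_natl.
rewrite lat_double dual_sum mulr_sumr; apply: eq_bigr => i _.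
rewrite dualMz dual_scaleE -[(_%:~R)](mulKf ell_scale_neq0) -ell_double.
by ring.
Qed.

Lemma form_latu0 b : (forall i j, b (latu i) (latu j) = 0) -> b = 0.
Proof.
move=> b0; have bu i y : b (latu i) y = 0.
  apply: (@mulfI _ 2); first by rewrite pnatr_eq0.
  rewrite mulr0 mulr_natl -symformMn lat_double symform_sum big1// => j _.
  by rewrite symformMz b0 mul0r.
apply: symformP => x y; rewrite symformC -[RHS]/0.
apply: (@mulfI _ 2); first by rewrite pnatr_eq0.
rewrite mulr0 mulr_natl -symformMn lat_double symform_sum big1// => j _.
by rewrite symformMz symformC bu mul0r.
Qed.

(** As [ell_i] is integer-valued, subtracting [ell_i(y)] times [x] from [y] lands in the kernel of
    [ell_i]. *)
Lemma ell_proportional f i x :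
  l i x = 1 -> (forall y, l i y = 0 -> f y = 0) -> f = f x *: l i.
Proof.
move=> x1 f0; apply: dualP => y; rewrite dual_scaleE.
have /intrP[z yz] := ell_int i y.
have : f (y - x *~ z) = 0.
  by apply: f0; rewrite dualB dualMz x1 yz mul1r subrr.
by rewrite dualB dualMz yz => /eqP; rewrite subr_eq0 => /eqP.
Qed.

(* A decomposition of [ell_i^2] only involves forms vanishing on the kernel of [ell_i]. *)
Lemma ell_sq_extremal i (P : set (dualR R L)) :
  cone [set sq m | m in P] (sq (l i)) ->
  exists2 m, P m & exists2 a : R, a != 0 & m = a *: l i.
Proof.
move=> [k [g [c [Pg c0 lE]]]].
have [x x1] := ell_eq1 i.
have lEE y : (l i y) ^+ 2 = \sum_j c j * g j y y.
  by rewrite expr2 -sqE lE symform_sumE; apply: eq_bigr.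
have g0 j y : 0 <= g j y y :> R.
  by have [m _ <-] := Pg j; rewrite sqE -expr2 sqr_ge0.
have [j cg] : exists j, c j * g j x x != 0.
  apply/existsP; rewrite -negb_forall; apply/negP => /forallP cg0.
  have := lEE x; rewrite big1 => [|j _]; last exact/eqP.
  by move=> /eqP; rewrite x1 expr1n oner_eq0.
have [m Pm mg] := Pg j; exists m => //; exists (m x).
  by apply: contraNneq cg => m0; rewrite -mg sqE m0 !mulr0.
apply: ell_proportional => // y ly.
have /eqP := lEE y; rewrite ly expr0n/= eq_sym psumr_eq0 => [|j' _]; last exact: mulr_ge0.
move=> /allP/(_ j); rewrite mem_index_enum => /(_ isT)/=; rewrite mulf_eq0.
have /negPf -> /= : c j != 0 by apply: contraNneq cg => ->; rewrite mul0r.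
by rewrite -mg sqE mulf_eq0 orbb => /eqP.
Qed.

Lemma ell_dualZ i : dualZ (l i).
Proof. exact: ell_int. Qed.

Lemma ell_neq0 i : l i <> 0.
Proof.
move=> l0; have [x] := ell_eq1 i; rewrite l0 -[LHS]/0 => /eqP.
by rewrite eq_sym oner_eq0.
Qed.

Lemma int_dvd1 (a : R) k : a \is a Num.int -> 1 = a *+ k -> k = 1%N.
Proof.
move=> /intrP[z ->]; rewrite [_ *+ k]pmulrn -mulrzA -[LHS]/(1%:~R) => /eqP.
rewrite eqr_int => /eqP/(congr1 absz)/esym/eqP.
by rewrite abszM muln_eq1 => /andP[_ /eqP].
Qed.

Lemma ell_primitive i : primitive (@dualZ R L) (l i).
Proof.
split; [exact: ell_dualZ|exact: ell_neq0|].
move=> k w wZ lw; have [x x1] := ell_eq1 i; apply: (int_dvd1 (wZ x)).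
by rewrite -x1 lw -[LHS]/(dual_ev x _) raddfMn.
Qed.

Lemma sq_ell_symZ i : symZ (sq (l i)).
Proof. by move=> x y; rewrite sqE rpredM ?ell_int. Qed.

Lemma sq_ell_primitive i : primitive (@symZ R L) (sq (l i)).
Proof.
have [x x1] := ell_eq1 i; have s1 : sq (l i) x x = 1 by rewrite sqE x1 mulr1.
split; [exact: sq_ell_symZ| |].
  by move=> s0; move: s1; rewrite s0 -[LHS]/0 => /eqP; rewrite eq_sym oner_eq0.
move=> k w wZ sw; apply: (int_dvd1 (wZ x x)).
by rewrite -s1 sw -[LHS]/(form_ev x x _) raddfMn.
Qed.

End Ell.

(** * Finitely generated cones and their faces *)

Section Cones.
Variables (R : realType) (V : lmodType R).
Implicit Types (G H : set V) (v : V).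

Lemma sub_cone G H : G `<=` H -> cone G `<=` cone H.
Proof. by move=> GH v [k [g [c [/(_ _)/GH Gg c0 ->]]]]; exists k, g, c. Qed.

Lemma mem_cone G v : G v -> cone G v.
Proof.
move=> Gv; exists 1%N, (fun=> v), (fun=> 1).
by split=> //; rewrite big_ord1 scale1r.
Qed.

Lemma scalar_sum (phi : {scalar V}) k (m : 'I_k -> V) (c : 'I_k -> R) :
  phi (\sum_i c i *: m i) = \sum_i c i * phi (m i).
Proof. by rewrite raddf_sum; apply: eq_bigr => i _; exact: scalarZ. Qed.

Lemma cone_rangeP k (m : 'I_k -> V) v :
  cone (range m) v <->
  exists2 c : 'I_k -> R, forall i, 0 <= c i & v = \sum_i c i *: m i.
Proof.
split=> [[p [g [c [/(_ _)/cid2 Gg c0 ->]]]]|[c c0 ->]]; last first.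
  by exists k, m, c; split=> // i; exists i.
pose h j := s2val (Gg j).
have hg j : m (h j) = g j by exact: (s2valP' (Gg j)).
(* Terms with the same generator are collected into one coefficient. *)
exists (fun i => \sum_(j | h j == i) c j) => [i|]; first exact: sumr_ge0.
rewrite (partition_big h xpredT)//=; apply: eq_bigr => i _.
by rewrite scaler_suml; apply: eq_bigr => j /eqP <-; rewrite hg.
Qed.

(** A sum of nonnegative terms vanishes only if each term does, so a face is generated by those
    generators on which its supporting functional vanishes. *)
Lemma face_cone_range k (m : 'I_k -> V) tau : face tau (cone (range m)) ->
  exists P : {set 'I_k}, tau = cone (range (fun j : 'I_#|P| => m (enum_val j))).
Proof.
move=> [phi phi0 ->].
have pm i : 0 <= phi (m i) by apply/phi0/mem_cone; exists i.
exists (finset (fun i => phi (m i) == 0)); apply/seteqP; split=> v /=.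
  move=> [/cone_rangeP[c c0 ->]]; rewrite scalar_sum => /eqP.
  rewrite psumr_eq0 => [/allP/= cp|i _]; last exact: mulr_ge0.
  apply/cone_rangeP; exists (fun j => c (enum_val j)) => //.
  rewrite -(big_enum_val (fun i => c i *: m i)) (bigID (fun i => phi (m i) == 0))/=.
  rewrite [X in _ + X]big1 ?addr0 => [|i pmi].
    by apply: eq_bigl => i; rewrite inE.
  have := cp i; rewrite mem_index_enum => /(_ isT).
  by rewrite mulf_eq0 (negPf pmi) orbF => /eqP ->; rewrite scale0r.
move=> /cone_rangeP[c c0 ->]; split.
  exists _, (fun j => m (enum_val j)), c.
  by split=> // j; exists (enum_val j).
rewrite scalar_sum big1// => j _.
by have := enum_valP j; rewrite inE => /eqP ->; rewrite mulr0.
Qed.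

End Cones.

(** * Rays and proper faces of the Friedman--Smith cone *)

Section FSCone.
Variables (R : realType) (n : nat).
Local Notation L := (FS_lattice n).
Local Notation l := (@ell R n).
Local Notation sigma := (FS_cone R n).

Lemma FS_rational_polyhedral : rational_polyhedral (@symZ R L) sigma.
Proof. by exists n, (fun i => sq (l i)); split=> //; exact: sq_ell_symZ. Qed.

Lemma FS_ray_gen v : ray_gen (@symZ R L) sigma v -> exists i, v = sq (l i).
Proof.
move=> [[vZ v0 vp] [phi phi0 vE]].
have /= : cone [set v] v by exact: mem_cone.
rewrite vE => -[sv pv].
move: (sv) => /cone_rangeP[c c0 vc].
have [i ci] : exists i, c i != 0.
  apply/existsP; rewrite -negb_forall; apply/negP => /forallP ci.
  by apply: v0; rewrite vc big1// => i _; rewrite (eqP (ci i)) scale0r.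
have sl j : sigma (sq (l j)) by apply: mem_cone; exists j.
(* The supporting functional vanishes at [v], hence on every generator that occurs in [v] with
   nonzero coefficient; such a generator lies on the ray of [v]. *)
exists i; have /= : cone [set v] (sq (l i)).
  rewrite vE; split; first exact: sl.
  move/eqP: pv; rewrite vc scalar_sum psumr_eq0 => [/allP/(_ i)|j _]; last first.
    by rewrite mulr_ge0// phi0.
  by rewrite mem_index_enum /= mulf_eq0 (negPf ci) => /(_ isT)/eqP.
move=> [k [g [d [gv d0 lE]]]].
have {}lE : sq (l i) = (\sum_j d j) *: v.
  by rewrite lE scaler_suml; apply: eq_bigr => j _; rewrite (gv j).
set a := \sum_j d j in lE; have a0 : 0 <= a by exact: sumr_ge0.
have [x x1] := ell_eq1 R i.
have av : a * v x x = 1 by rewrite -symform_scaleE -lE sqE x1 mulr1.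
have vE' : v = v x x *: sq (l i).
  by rewrite lE scalerA mulrC av scale1r.
have : 0 <= v x x.
  by rewrite -(pmulr_rge0 _ (_ : 0 < a)) ?av// lt_neqAle a0 andbT;
    apply/negP => /eqP a00; move: av; rewrite -a00 mul0r => /eqP;
    rewrite eq_sym oner_eq0.
have /intrP[z zE] := vZ x x; rewrite zE ler0z => z0.
(* Now [v] is a nonnegative integer multiple of [ell_i^2], and primitivity of [v] makes the factor
   1. *)
have k1 : `|z|%N = 1%N.
  apply: (vp _ (sq (l i))); first exact: sq_ell_symZ.
  by rewrite {1}vE' zE -{1}(gez0_abs z0) -scaler_nat.
by rewrite vE' zE -(gez0_abs z0) k1 scale1r.
Qed.

(** Evaluation at the dual vectors [x i] reads off the coefficients of a real combination, which are
    thus integers as soon as the combination is integral. *)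
Lemma unimodular_zbasis r (s : 'I_r -> 'I_n) (x : 'I_r -> L) :
  (forall i j, l (s j) (x i) = (j == i)%:R) ->
  zbasis (rspan (l \o s) `&` @dualZ R L) (l \o s).
Proof.
move=> lx.
have ev (c : 'I_r -> R) i : (\sum_j c j *: l (s j)) (x i) = c i :> R.
  rewrite dual_sumE; under eq_bigr do rewrite dual_scaleE lx.
  by rewrite (bigD1 i)//= eqxx mulr1 big1 ?addr0// => j /negPf ->; rewrite mulr0.
split=> [i|c c0 i|v [[c vc] vZ]].
- split; last exact: ell_dualZ.
  exists (fun j => (j == i)%:R); rewrite (bigD1 i)//= eqxx scale1r big1 ?addr0//.
  by move=> j /negPf ->; rewrite scale0r.
- have := ev (fun j => (c j)%:~R) i; under eq_bigr do rewrite scaler_int.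
  by rewrite c0 -[LHS]/0 => /esym/eqP; rewrite intr_eq0 => /eqP.
- have cZ i : c i \is a Num.int by rewrite -ev -vc; exact: vZ.
  exists (fun i => Num.floor (c i)); rewrite vc; apply: eq_bigr => i _.
  by rewrite -[LHS]/(c i *: l (s i)) -{1}(floorK (cZ i)) scaler_int.
Qed.

(** A proper face omits some index [i0], and the lattice vectors [e_i + e_{i0}] are dual to the
    remaining [ell_i]. *)
Lemma FS_proper_face_matroidal tau : proper_face tau sigma -> matroidal tau.
Proof.
move=> [/face_cone_range[P tauE] tau_sigma].
have [i0 i0P] : exists i, i \notin P.
  apply/existsP; rewrite -negb_forall; apply/negP => /forallP PT.
  apply: tau_sigma; rewrite tauE; congr cone; apply/seteqP; split=> _ [i _ <-].
    by exists (enum_val i).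
  by exists (enum_rank_in (PT i) i) => //; rewrite enum_rankK_in.
exists #|P|, (fun j => l (enum_val j)); split=> //.
  by move=> i; exact: ell_primitive.
move=> r s s_inj _.
have ne i : enum_val (s i) != i0.
  by apply: contraNneq i0P => <-; exact: enum_valP.
apply: (@unimodular_zbasis _ (enum_val \o s) (fun i => latw (enum_val (s i)) i0)).
move=> i j; rewrite ell_latw /=.
  by rewrite (negPf (ne j)) addr0 (inj_eq enum_val_inj) (inj_eq s_inj).
apply/eqP => n1; have := ne i; rewrite -val_eqE/=.
by move: (ltn_ord (enum_val (s i))) (ltn_ord i0); lia.
Qed.

Lemma FS1_matroidal : n = 1%N -> matroidal sigma.
Proof.
move=> n1; exists n, l; split=> //; first exact: ell_primitive.
move=> r s s_inj _; apply: (@unimodular_zbasis _ s (fun i => latu (s i))).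
move=> i j; rewrite ell_latu /ell_scale (introT eqP n1) mul1r.
by rewrite (inj_eq s_inj).
Qed.

End FSCone.

(** * Half sums of the [ell_i] and averages over signs *)

Section Half.
Variables (R : realType) (n : nat).
Local Notation L := (FS_lattice n).
Local Notation l := (@ell R n).
Local Notation sigma := (FS_cone R n).
Local Notation signs := {ffun 'I_n -> bool}.
Implicit Types (s : signs) (Q : {dot (dualR R L) for idfun}).

(** Flipping the sign at [i] negates the coefficient of [beta i j] for [j != i], so only the
    diagonal survives the summation. *)
Lemma sum_signs (beta : 'I_n -> 'I_n -> R) :
  \sum_(s : signs) \sum_i \sum_j (-1) ^+ s i * (-1) ^+ s j * beta i j =
  2 ^+ n * \sum_i beta i i.
Proof.
have sgn0 i j : i != j -> \sum_(s : signs) (-1) ^+ s i * (-1) ^+ s j = 0 :> R.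
  move=> ij; pose flip s : signs := [ffun k => (k == i) (+) s k].
  have flipK : involutive flip.
    by move=> s; apply/ffunP => k; rewrite !ffunE addbA addbb.
  have : \sum_(s : signs) (-1) ^+ s i * (-1) ^+ s j
       = - \sum_(s : signs) (-1) ^+ s i * (-1) ^+ s j :> R.
    rewrite {1}(reindex_inj (inv_inj flipK)) -sumrN; apply: eq_bigr => s _.
    by rewrite !ffunE eqxx eq_sym (negPf ij)/= signrN mulNr.
  lra.
rewrite exchange_big mulr_sumr; apply: eq_bigr => i _.
rewrite exchange_big (bigD1 i)//= [X in _ + X]big1 ?addr0 => [|j ji].
  rewrite -mulr_suml; congr (_ * _).
  under eq_bigr do rewrite -expr2 sqrr_sign.
  by rewrite sumr_const card_ffun card_bool card_ord natrX.
by rewrite -mulr_suml sgn0 ?mul0r// eq_sym.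
Qed.

(** The sign is minus where [s i] holds; the constant [false] gives the vector [h]. *)
Definition half_sum s : dualR R L := 2^-1 *: \sum_i (-1) ^+ s i *: l i.

(** Changing signs alters [sum_i d_i] by an even number, and that sum is even. *)
Lemma half_sum_dualZ s : n != 1%N -> dualZ (half_sum s).
Proof.
move=> n1 x; have [k kE] := lat_coord_even x.
rewrite dual_scaleE dual_sumE.
suff -> : \sum_i ((-1) ^+ s i *: l i) x =
    2 * (k - \sum_(i | s i) lat_coord i x)%:~R :> R.
  by rewrite mulKf ?pnatr_eq0// intr_int.
rewrite -[2]/(2%:~R) -intrM mulrBr [2 * k]mulr_natl -kE.
rewrite mulr_sumr [X in _ - X]big_mkcond -sumrB rmorph_sum; apply: eq_bigr => i _.
rewrite dual_scaleE ell_coord//; case: (s i).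
  by rewrite expr1 mulN1r -rmorphN/=; congr (_%:~R); ring.
by rewrite expr0 mul1r subr0.
Qed.

Lemma half_sum_latu s i : half_sum s (latu i) = 2^-1 * (ell_scale R n * (-1) ^+ s i).
Proof.
rewrite dual_scaleE dual_sumE; under eq_bigr do rewrite dual_scaleE ell_latu.
rewrite (bigD1 i)//= eqxx mulr1 big1 ?addr0 => [|j /negPf ->].
  by rewrite [X in _ * X]mulrC.
by rewrite !mulr0.
Qed.

Lemma half_sum_neq0 s (i : 'I_n) : half_sum s <> 0.
Proof.
move=> s0; have := half_sum_latu s i; rewrite s0 -[LHS]/0 => /esym/eqP.
by rewrite !mulf_eq0 invr_eq0 pnatr_eq0 (negPf (ell_scale_neq0 R n)) signr_eq0.
Qed.

Lemma sum_sq_half : \sum_(s : signs) sq (half_sum s) = (2 ^+ n / 4) *: \sum_i sq (l i).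
Proof.
apply: symformP => x y; rewrite symform_sumE symform_scaleE symform_sumE.
have := sum_signs (fun i j => l i x * l j y); rewrite mulrAC => <-.
rewrite mulr_suml; apply: eq_bigr => s _.
rewrite sqE !dual_scaleE !dual_sumE mulrACA big_distrlr/= mulrC.
have -> : 2^-1 * 2^-1 = 4^-1 :> R by field.
congr (_ * _); apply: eq_bigr => i _; apply: eq_bigr => j _.
by rewrite mulrACA.
Qed.

Lemma dotC Q f g : Q f g = Q g f.
Proof. by rewrite (hermC Q) expr0 mul1r. Qed.

Lemma dotZr Q a f g : Q f (a *: g) = a * Q f g.
Proof. exact: linearr_subproof. Qed.

Lemma dotZl Q a f g : Q (a *: f) g = a * Q f g.
Proof. by rewrite dotC dotZr dotC. Qed.

Lemma dot_sum Q (a : 'I_n -> R) :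
  Q (\sum_i a i *: l i) (\sum_i a i *: l i) =
  \sum_i \sum_j a i * a j * Q (l i) (l j).
Proof.
rewrite dotC raddf_sum; apply: eq_bigr => i _.
rewrite /= dotZr dotC raddf_sum mulr_sumr; apply: eq_bigr => j _.
by rewrite /= dotZr dotC mulrA.
Qed.

Lemma sum_dot_half Q : (forall i, Q (l i) (l i) = 1) ->
  \sum_(s : signs) Q (half_sum s) (half_sum s) = 2 ^+ n * (n%:R / 4).
Proof.
move=> Q1; have := sum_signs (fun i j => Q (l i) (l j)).
rewrite [X in _ = _ * X](eq_bigr (fun=> 1)) => [|i _]; last exact: Q1.
rewrite sumr_const card_ord mulrA => <-; rewrite mulr_suml; apply: eq_bigr => s _.
rewrite dotZl dotZr dot_sum mulrA; by field.
Qed.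

End Half.

(** * Failure of matroidality for [n >= 2]; simpliciality; failure of basicness for [n = 2] *)

Section FSConeNegative.
Variables (R : realType) (n : nat).
Local Notation L := (FS_lattice n).
Local Notation l := (@ell R n).
Local Notation sigma := (FS_cone R n).

Lemma primitive_scale_ell (m : dualR R L) (a : R) i :
  primitive (@dualZ R L) m -> m = a *: l i -> a = 1 \/ a = -1.
Proof.
move=> [mZ m0 mp] mE; have [x x1] := ell_eq1 R i.
have : m x = a by rewrite mE dual_scaleE x1 mulr1.
have /intrP[z ->] := mZ x => az; move: mE; rewrite -az.
have lZ e : dualZ ((-1) ^+ e *: l i).
  by move=> y; rewrite dual_scaleE rpredM ?ell_int// rpredX ?rpredN ?rpred1.
move=> mE; have : `|z|%N = 1%N.
  apply: (mp _ ((-1) ^+ (z < 0)%R *: l i) (lZ _)).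
  rewrite mE -scaler_nat scalerA {1}[z]intEsign rmorphM rmorph_sign/=.
  by rewrite mulrC.
by move: z {az mE} => [[|[|k]]|[|k]]//= _; [left|right].
Qed.

Lemma FS_not_matroidal : (2 <= n)%N -> ~ matroidal sigma.
Proof.
move=> n2 [k [m [mp sE mZ]]].
have n1 : n != 1%N by lia.
(* By extremality of [ell_i^2] and primitivity of the [m j], each [ell_i] occurs among the [m j] up
   to sign. *)
have sm i : exists j, exists a : R, (a = 1 \/ a = -1) /\ m j = a *: l i.
  have : sigma (sq (l i)) by apply: mem_cone; exists i.
  rewrite sE => /(sub_cone (H := [set sq f | f in range m]))[].
    by move=> _ [j _ <-]; exists (m j) => //; exists j.
  move=> p [g [c gP]]; have : cone [set sq f | f in range m] (sq (l i)).
    by exists p, g, c.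
  move=> /ell_sq_extremal[_ [j _ <-] [a _ mE]].
  by exists j, a; split=> //; exact: primitive_scale_ell mE.
have [s /choice[a aP]] := choice sm.
have a_eq i : m (s i) = a i *: l i by case: (aP i).
have a1 i : a i = 1 \/ a i = -1 by case: (aP i).
have a0 i : a i != 0 by case: (a1 i) => ->; rewrite ?oppr_eq0 oner_neq0.
have ev i j : m (s i) (latu j) = a i * (ell_scale R n * (i == j)%:R).
  by rewrite a_eq dual_scaleE ell_latu.
have r0 := ell_scale_neq0 R n.
have s_inj : injective s.
  move=> i j sij; apply/eqP; apply: contraT => ij.
  have := ev i i; rewrite sij ev eqxx [j == i]eq_sym (negPf ij) mulr1 !mulr0.
  by move=> /esym/eqP; rewrite mulf_eq0 (negPf (a0 i)) (negPf r0).
have m_ind : lin_indep (m \o s).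
  move=> c cm i; have := congr1 (dual_ev (latu i)) cm.
  rewrite (scalar_sum (dual_ev _)) (bigD1 i)//= /dual_ev big1.
    rewrite ev eqxx mulr1 addr0 -[RHS]/0 => /eqP.
    by rewrite !mulf_eq0 (negPf (a0 i)) (negPf r0) !orbF => /eqP.
  by move=> j /negPf ji; rewrite ev ji !mulr0.
(* The vector [h] is integral and lies in the real span of these [m (s i)], so it would be an
   integral combination of them. *)
have [_ _ /(_ (half_sum R [ffun=> false]))[]] := mZ _ s s_inj m_ind.
  split; last exact: half_sum_dualZ.
  exists (fun i => 2^-1 * a i); rewrite /half_sum scaler_sumr; apply: eq_bigr => i _.
  rewrite /= a_eq !scalerA ffunE mulr1 -mulrA.
  by case: (a1 i) => ->; rewrite ?mulrNN mulr1 ?mulr1.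
(* Evaluation at [latu i0] shows that a coefficient of this combination would be [1/2] up to
   sign. *)
move=> z hE; pose i0 := Ordinal n2.
have := half_sum_latu R [ffun=> false] i0; rewrite hE dual_sumE (bigD1 i0)//= big1; last first.
  by move=> j /negPf ji; rewrite dual_mulzE ev ji !mulr0 mul0r.
rewrite dual_mulzE ev eqxx ffunE !mulr1 addr0 mulrAC => /(mulIf r0).
move=> /(congr1 ( *%R 2)); rewrite divff ?pnatr_eq0//.
have [e [-> e1]] : exists e : int, a i0 = e%:~R /\ (e = 1 \/ e = -1).
  by case: (a1 i0) => ->; [exists 1|exists (-1)]; split; auto.
rewrite -[2]/(2%:~R) -!intrM -[1]/(1%:~R) => /eqP; rewrite eqr_int => /eqP.
by case: e1 => ->; lia.
Qed.

(** The ray generators are among the [ell_i^2], and evaluation at [latu i] in both arguments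
    isolates the coefficient of [ell_i^2]. *)
Lemma FS_simplicial : simplicial (@symZ R L) sigma.
Proof.
split=> [|k m m_inj m_ray c cm i]; first exact: FS_rational_polyhedral.
have [t mE] := choice (fun i => FS_ray_gen (m_ray i)).
have := congr1 (form_ev (latu (t i)) (latu (t i))) cm.
rewrite (scalar_sum (form_ev _ _)) (bigD1 i)//= /form_ev big1 => [|j ji].
  rewrite mE sqE ell_latu eqxx mulr1 addr0 -[RHS]/0 => /eqP.
  by rewrite !mulf_eq0 orbb (negPf (ell_scale_neq0 R n)) orbF => /eqP.
rewrite mE sqE ell_latu.
suff /negPf -> : t j != t i by rewrite !mulr0.
by apply: contra_neq ji => tij; apply: m_inj; rewrite !mE tij.
Qed.

(** The supporting functional is evaluation at [latu j] in both arguments: it kills [ell_i^2] and is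
    positive on [ell_j^2]. *)
Lemma FS2_ray_gen i j : i != j -> (forall k, k = i \/ k = j) ->
  ray_gen (@symZ R L) sigma (sq (l i)).
Proof.
move=> ij ijP; split; first exact: sq_ell_primitive.
have evj c : (\sum_k c k *: sq (l k)) (latu j) (latu j) = c j * (ell_scale R n) ^+ 2.
  rewrite symform_lincombE; under eq_bigr do rewrite sqE ell_latu.
  rewrite (bigD1 j)//= eqxx mulr1 big1 ?addr0 => [|k /negPf ->]; first by [].
  by rewrite !mulr0.
exists (form_ev (latu j) (latu j)) => [v /cone_rangeP[c c0 ->]|].
  by rewrite [X in 0 <= X]evj mulr_ge0// sqr_ge0.
apply/seteqP; split=> v /=.
  move=> [k [g [c [gP c0 ->]]]].
  have -> : \sum_k c k *: g k = (\sum_k c k) *: sq (l i).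
    by rewrite scaler_suml; apply: eq_bigr => p _; rewrite (gP p).
  split; last first.
    by rewrite /form_ev symform_scaleE sqE ell_latu (negPf ij) !mulr0.
  exists 1%N, (fun=> sq (l i)), (fun=> \sum_k c k); split; last by rewrite big_ord1.
    by move=> _; exists i.
  by move=> _; exact: sumr_ge0.
move=> [/cone_rangeP[c c0 ->] vj]; have /eqP := evj c.
rewrite [X in X == _]vj eq_sym mulf_eq0 expf_eq0 (negPf (ell_scale_neq0 R n)) orbF => /eqP cj.
exists 1%N, (fun=> sq (l i)), (fun=> c i); split=> //.
rewrite big_ord1 (bigD1 i)//= big1 ?addr0// => k ki.
by case: (ijP k) => kE; rewrite kE ?cj ?scale0r//; move: ki; rewrite kE eqxx.
Qed.

Lemma FS2_not_basic : n = 2%N -> ~ basic (@symZ R L) sigma.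
Proof.
move=> n2 [_ [k [b [[_ b_ind b_gen] b_ray]]]].
have n0 : (0 < n)%N by lia.
have n1 : (1 < n)%N by lia.
pose i := Ordinal n0; pose j := Ordinal n1.
have ij : i != j by [].
have ijP p : p = i \/ p = j.
  case: (eqVneq p i) => [|pi]; first by left.
  right; apply/eqP; move: pi; rewrite -!val_eqE/=; move: (ltn_ord p); lia.
have [p _ bp] := b_ray _ (FS2_ray_gen ij ijP).
have [q _ bq] : range b (sq (l j)).
  by apply/b_ray/FS2_ray_gen; [rewrite eq_sym; exact: ij|by move=> r; case: (ijP r); auto].
have pq : q != p.
  apply/eqP => qp; move: bq; rewrite qp bp.
  move=> /(congr1 (form_ev (latu i) (latu i))); rewrite /form_ev !sqE !ell_latu.
  rewrite eqxx eq_sym (negPf ij) mulr1 !mulr0 => /eqP.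
  by rewrite mulf_eq0 orbb (negPf (ell_scale_neq0 R n)).
have sumE (z : L) : exists u : int, lat_coord i z = u *+ 2 - lat_coord j z.
  have [u uE] := lat_coord_even z; exists u; rewrite -uE (bigD1 i)//= (bigD1 j)//= big1.
    by rewrite addr0 addrK.
  by move=> t /andP[ti tj]; case: (ijP t) => tE; move: ti tj; rewrite tE eqxx.
have n1' : n != 1%N by lia.
(* The form [(ell_i^2 - ell_j^2) / 2] is integral, because [d_i] and [d_j] have the same parity. *)
have [|c cE] := b_gen (2^-1 *: (sq (l i) - sq (l j))).
  move=> x y; have [u uE] := sumE x; have [v vE] := sumE y.
  rewrite symform_scaleE symformBE !sqE !ell_coord// uE vE.
  suff -> : 2^-1 * ((u *+ 2 - lat_coord j x)%:~R * (v *+ 2 - lat_coord j y)%:~R -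
      (lat_coord j x)%:~R * (lat_coord j y)%:~R) =
      (u * v *+ 2 - u * lat_coord j y - v * lat_coord j x)%:~R :> R by exact: intr_int.
  by rewrite !(rmorphB, rmorphM, rmorphMn)/=; field.
(* Doubling the expansion of that form gives a relation among the basis vectors whose coefficient at
   [p] is [2 c_p - 1], which is odd. *)
have := b_ind (fun r => c r *+ 2 - (r == p)%:R + (r == q)%:R).
have -> : \sum_r b r *~ (c r *+ 2 - (r == p)%:R + (r == q)%:R) = 0.
  under eq_bigr do rewrite mulrzDr mulrzBr mulr2n mulrzDr.
  rewrite big_split sumrB big_split -cE/= -scalerDl.
  have delta r' : \sum_r b r *~ (r == r')%:R = b r'.
    rewrite (bigD1 r')//= eqxx mulr1z big1 ?addr0// => r /negPf ->.
    by rewrite mulr0z.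
  rewrite !delta bp bq (_ : 2^-1 + 2^-1 = 1); last by field.
  by rewrite scale1r [_ - _ - _]addrAC subrr sub0r addNr.
move=> /(_ erefl p); rewrite eqxx eq_sym (negPf pq); lia.
Qed.

End FSConeNegative.

(** * Integral bases from dual coordinates, and basicness for [n = 1] and [n >= 3] *)

Lemma zbasis_of_dual (R : realType) (V : lmodType R) (L : set V) (T : finType)
    (m : T -> V) (t : T -> V -> R) :
  (forall a, scalar (t a)) -> (forall a, L (m a)) ->
  (forall a b, t a (m b) = (a == b)%:R) ->
  (forall v, L v -> forall a, t a v \is a Num.int) ->
  (forall v, (forall a, t a v = 0) -> v = 0) ->
  exists k (b : 'I_k -> V), zbasis L b /\ forall a, range b (m a).
Proof.
move=> t_lin mL tm tZ t0.
have t_sum a k (w : 'I_k -> V) (c : 'I_k -> int) :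
    t a (\sum_i w i *~ c i) = \sum_i (c i)%:~R * t a (w i).
  pose phi : {scalar V} := HB.pack (t a) (GRing.isLinear.Build _ _ _ _ (t a) (t_lin a)).
  transitivity (phi (\sum_i (c i)%:~R *: w i)); last exact: scalar_sum.
  by congr (phi _); apply: eq_bigr => i _; rewrite scaler_int.
have t_comb (c : 'I_#|T| -> int) i :
    t (enum_val i) (\sum_j m (enum_val j) *~ c j) = (c i)%:~R.
  rewrite t_sum (bigD1 i)//= tm eqxx mulr1 big1 ?addr0// => j /negPf ji.
  by rewrite tm (inj_eq enum_val_inj) eq_sym ji mulr0.
exists #|T|, (fun i => m (enum_val i)); split; last first.
  by move=> a; exists (enum_rank a) => //; rewrite enum_rankK.
split=> // [c c0 i|v vL].
  have : t (enum_val i) 0 = 0.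
    by have := t_lin (enum_val i) (-1) 0 0; rewrite scaler0 addr0 mulN1r addNr.
  by rewrite -c0 t_comb => /eqP; rewrite intr_eq0 => /eqP.
(* The coordinates [t a v] are integers, so the floor only converts their type; the difference of
   both sides has all coordinates zero. *)
exists (fun i => Num.floor (t (enum_val i) v)).
apply/eqP; rewrite -subr_eq0; apply/eqP/t0 => a.
have -> u w : t a (u - w) = t a u - t a w by rewrite addrC -scaleN1r t_lin mulN1r addrC.
rewrite -{2}(enum_rankK a) t_comb enum_rankK floorK ?subrr//; exact: tZ.
Qed.

Section Basic.
Variables (R : realType) (n : nat).
Local Notation L := (FS_lattice n).
Local Notation l := (@ell R n).
Local Notation sigma := (FS_cone R n).

Lemma FS_basic_of_dual (T : finType) (m : T -> symR R L) (t : T -> symR R L -> R) :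
  (forall a, scalar (t a)) -> (forall a, symZ (m a)) ->
  (forall a b, t a (m b) = (a == b)%:R) ->
  (forall v, symZ v -> forall a, t a v \is a Num.int) ->
  (forall v, (forall a, t a v = 0) -> v = 0) ->
  (forall i, exists a, m a = sq (l i)) -> basic (@symZ R L) sigma.
Proof.
move=> t_lin mL tm tZ t0 ml; split; first exact: FS_rational_polyhedral.
have [k [b [b_basis b_range]]] := zbasis_of_dual t_lin mL tm tZ t0.
exists k, b; split=> // v /FS_ray_gen[i ->].
by have [a <-] := ml i.
Qed.

(** Integral forms have rank one here, and evaluation at [latu i] is the coordinate dual to
    [ell_i^2]. *)
Lemma FS1_basic : n = 1%N -> basic (@symZ R L) sigma.
Proof.
move=> n1; have eq1 (i j : 'I_n) : i = j.
  by apply: val_inj => /=; move: (ltn_ord i) (ltn_ord j); lia.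
apply: (@FS_basic_of_dual _ (fun i => sq (l i)) (fun i v => v (latu i) (latu i))).
- by [].
- by move=> i; exact: sq_ell_symZ.
- move=> i j; rewrite sqE ell_latu (eq1 i j) eqxx mulr1.
  by rewrite /ell_scale (introT eqP n1) mulr1.
- by move=> v vZ i; exact: vZ.
- by move=> v v0; apply: form_latu0 => i j; rewrite (eq1 i j) v0.
- by move=> i; exists i.
Qed.

Section Exchange.
Variables (a b c : 'I_n).
Hypotheses (ab : a != b) (ac : a != c) (bc : (b < c)%N).

Let n1 : n != 1%N.
Proof. by move: (ltn_ord c) bc; lia. Qed.

Let scale2 : ell_scale R n = 2.
Proof. by rewrite /ell_scale (negPf n1). Qed.

(** In coordinates these are [2 e_a] and [e_i - e_a] for [i != a], the basis dual to [h] and the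
    [ell_i] with [i != a]. *)
Definition lat_basis (i : 'I_n) : L :=
  if i == a then latu a else latw a i - latu a.

Definition dual_basis (i : 'I_n) : dualR R L :=
  if i == a then half_sum R [ffun=> false] else l i.

Lemma ell_lat_basis i : i != a -> l a (lat_basis i) = -1.
Proof.
move=> ia; rewrite /lat_basis (negPf ia) dualB ell_latw// ell_latu eqxx scale2.
by rewrite eq_sym (negPf ia) addr0 mulr1 /=; lra.
Qed.

Lemma dual_basisE i j : dual_basis i (lat_basis j) = (i == j)%:R.
Proof.
have hu (k : 'I_n) : half_sum R [ffun=> false] (latu k) = 1.
  by rewrite half_sum_latu ffunE scale2 mulr1 mulVf ?pnatr_eq0.
have hw (k : 'I_n) : half_sum R [ffun=> false] (latw a k) = 1.
  apply: (@mulIf _ 2); first by rewrite pnatr_eq0.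
  have := congr1 (half_sum R [ffun=> false]) (latw_double a k).
  by rewrite dualMn dualD !hu mulr_natr => ->; rewrite mul1r.
rewrite /dual_basis /lat_basis; case: (eqVneq i a) => [->|ia].
  by rewrite [a == j]eq_sym; case: (j == a); rewrite ?hu// dualB hw hu subrr.
case: (eqVneq j a) => [->|ja]; first by rewrite ell_latu (negPf ia) mulr0.
by rewrite dualB ell_latw// ell_latu (negPf ia) add0r mulr0 subr0.
Qed.

Lemma dual_basis_dualZ i : dualZ (dual_basis i).
Proof.
by rewrite /dual_basis; case: ifP => _; [exact: half_sum_dualZ|exact: ell_dualZ].
Qed.

Lemma form_lat_basis0 (v : symR R L) :
  (forall i j : 'I_n, (i <= j)%N -> v (lat_basis i) (lat_basis j) = 0) -> v = 0.
Proof.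
move=> v0'; have v0 i j : v (lat_basis i) (lat_basis j) = 0.
  by case: (leqP i j) => [/v0'//|/ltnW/v0']; rewrite symformC.
(* This is [2 e_j = 2 (e_j - e_a) + 2 e_a], with multiplier 0 in place of 2 if [j = a]. *)
have uE j : exists k, latu j = lat_basis j *+ k + lat_basis a.
  rewrite /lat_basis eqxx; case: (eqVneq j a) => [->|ja]; first by exists 0%N; rewrite add0r.
  by exists 2%N; rewrite mulrnBl latw_double mulr2n opprD addrA subrK addrAC subrr add0r.
have vu i j : v (lat_basis i) (latu j) = 0.
  by have [k ->] := uE j; rewrite symformD symformMn !v0 mul0rn addr0.
apply: form_latu0 => i j; have [k ->] := uE i.
by rewrite symformC symformD symformMn ![v (latu j) _]symformC !vu mul0rn addr0.
Qed.

(** The product as an element of a basis of integral forms: [f g + g f] for distinct factors, but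
    the plain square, without the factor 2, for equal ones. *)
Definition sym_prod (f g : dualR R L) : symR R L :=
  if f == g then sq f else sq (f + g) - sq f - sq g.

Lemma sym_prodE f g x y :
  sym_prod f g x y = f x * g y + (f != g)%:R * (g x * f y) :> R.
Proof.
rewrite /sym_prod; case: eqVneq => [<-|_]; first by rewrite sqE mul0r addr0.
by rewrite !symformBE !sqE !dualDE mul1r; ring.
Qed.

Lemma dual_basis_inj : injective dual_basis.
Proof.
move=> i j ij; apply/eqP; have := dual_basisE i j; rewrite ij dual_basisE eqxx.
by case: (i == j) => // /eqP; rewrite oner_eq0.
Qed.

Lemma sym_prod_symZ f g : dualZ f -> dualZ g -> symZ (sym_prod f g).
Proof.
move=> fZ gZ x y; rewrite sym_prodE rpredD ?rpredM ?natr_int//; first [exact: fZ|exact: gZ].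
Qed.

Let T : finType := {p : 'I_n * 'I_n | (p.1 <= p.2)%N}.
Let bcT : T := Sub (b, c) (ltnW bc).
Let ev (p : T) (v : symR R L) : R := v (lat_basis (val p).1) (lat_basis (val p).2).

(* In the basis of products of the dual basis, [ell_a^2] has coefficient 1 on the
   product of the elements [b] and [c], which it can therefore replace. *)
Lemma FS_basic_exchange : basic (@symZ R L) sigma.
Proof.
pose m (p : T) := if p == bcT then sq (l a) else
  sym_prod (dual_basis (val p).1) (dual_basis (val p).2).
(* Coordinates dual to [m]: the contribution of [ell_a^2], whose multiplicity is read off at
   [(b, c)], is removed from every other coordinate. *)
pose t (p : T) (v : symR R L) :=
  ev p v - (p != bcT)%:R * ev p (sq (l a)) * ev bcT v.
have ba : b != a by rewrite eq_sym.
have ca : c != a by rewrite eq_sym.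
have ev_bc : ev bcT (sq (l a)) = 1.
  by rewrite /ev sqE !ell_lat_basis// mulrNN mulr1.
have ev_prod p (q : T) :
    ev p (sym_prod (dual_basis (val q).1) (dual_basis (val q).2)) = (p == q)%:R.
  rewrite /ev sym_prodE !dual_basisE (inj_eq dual_basis_inj).
  case: p q => [[p1 p2] /= p12] [[q1 q2] /= q12].
  rewrite -[in RHS](inj_eq val_inj)/= xpair_eqE -!val_eqE /=.
  do ![case: eqP => ? /=]; rewrite ?(mulr0, mul0r, mulr1, addr0, add0r)//; lia.
apply: (@FS_basic_of_dual T m t).
- by move=> p k v w; rewrite /t /ev !symformDE !symform_scaleE; ring.
- move=> p; rewrite /m; case: ifP => _; first exact: sq_ell_symZ.
  by apply: sym_prod_symZ; exact: dual_basis_dualZ.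
- move=> p q; rewrite /t /m; case: (eqVneq q bcT) => [->|qbc].
    rewrite ev_bc mulr1; case: eqVneq => [->|_]; first by rewrite ev_bc mul0r subr0.
    by rewrite mul1r subrr.
  by rewrite !ev_prod [bcT == q]eq_sym (negPf qbc) mulr0 subr0.
- move=> v vZ p; rewrite /t rpredB ?rpredM ?natr_int ?ell_int//; exact: vZ.
- move=> v v0; have vbc : ev bcT v = 0.
    by have := v0 bcT; rewrite /t eqxx mul0r mul0r subr0.
  apply: form_lat_basis0 => i j ij.
  by have := v0 (Sub (i, j) ij); rewrite /t vbc mulr0 subr0.
- move=> i; case: (eqVneq i a) => [->|ia].
    by exists bcT; rewrite /m eqxx.
  pose p : T := Sub (i, i) (leqnn i).
  (* As [b < c], the exchange leaves the diagonal products, in particular the other squares, in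
     place. *)
  have /negPf pbc : p != bcT.
    by apply/eqP => /(congr1 val)[ib ic]; move: bc; rewrite -ib -ic ltnn.
  by exists p; rewrite /m pbc /sym_prod eqxx /dual_basis (negPf ia).
Qed.

End Exchange.

Lemma FS_basic : (3 <= n)%N -> basic (@symZ R L) sigma.
Proof.
move=> n3; have n2 : (1 < n)%N by lia. have n1 : (0 < n)%N by lia.
exact: (@FS_basic_exchange (Ordinal n1) (Ordinal n2) (Ordinal n3)).
Qed.

End Basic.

(** * The standard form and its minimal vectors *)

Section StdDot.
Variables (R : realType) (n : nat).
Local Notation L := (FS_lattice n).
Local Notation l := (@ell R n).
Local Notation sigma := (FS_cone R n).
Implicit Types f g : dualR R L.

Let ell_coef f i : R := f (latu i) / ell_scale R n.

(** The inner product for which the [ell_i] are orthonormal. *)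
Definition std_dot f g : R := \sum_i ell_coef f i * ell_coef g i.

Lemma std_dotC f g : std_dot f g = std_dot g f.
Proof. by apply: eq_bigr => i _; rewrite mulrC. Qed.

Lemma std_dotBr f : zmod_morphism (std_dot f).
Proof.
move=> g h; rewrite /std_dot -sumrB; apply: eq_bigr => i _.
by rewrite /ell_coef dualBE; ring.
Qed.

Lemma std_dotZr f : scalable_for *%R (std_dot f).
Proof.
move=> a g; rewrite /std_dot mulr_sumr; apply: eq_bigr => i _.
by rewrite /ell_coef dual_scaleE; ring.
Qed.

Lemma std_dotBl g : zmod_morphism (std_dot ^~ g).
Proof. by move=> f h /=; rewrite ![std_dot _ g]std_dotC std_dotBr. Qed.

Lemma std_dotZl g : scalable_for *%R (std_dot ^~ g).
Proof. by move=> a f /=; rewrite ![std_dot _ g]std_dotC std_dotZr. Qed.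

Lemma std_dot_gt0 f : f != 0 -> 0 < std_dot f f.
Proof.
move=> f0; rewrite lt_neqAle; apply/andP; split; last first.
  by apply: sumr_ge0 => i _; rewrite -expr2 sqr_ge0.
apply: contra f0 => /eqP/esym/eqP; rewrite psumr_eq0 => [/allP/= c0|i _]; last first.
  by rewrite -expr2 sqr_ge0.
rewrite [f]dual_decomp big1// => i _; have := c0 i; rewrite mem_index_enum.
by rewrite mulf_eq0 orbb => /(_ isT)/eqP; rewrite /ell_coef => ->; rewrite scale0r.
Qed.

HB.instance Definition _ := isBilinear.Build R (dualR R L) (dualR R L) R
  *%R (idfun \; *%R) std_dot std_dotBl std_dotBr std_dotZl std_dotZr.

Lemma std_dot_hermitian f g : std_dot f g = (-1) ^+ false * idfun (std_dot g f).
Proof. by rewrite expr0 mul1r std_dotC. Qed.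
HB.instance Definition _ := isHermitianSesquilinear.Build R (dualR R L) false idfun
  std_dot std_dot_hermitian.
HB.instance Definition _ := isDotProduct.Build R (dualR R L) std_dot std_dot_gt0.

Lemma std_dotE f : std_dot f f = \sum_i ell_coef f i ^+ 2.
Proof. by apply: eq_bigr. Qed.

(* The dual of the lattice [D_n] is the union of [Z^n] and its translate by
   the vector with all entries [1/2]. *)
Lemma dualZ_coef f : dualZ f ->
  (forall i, ell_coef f i \is a Num.int) \/
  n != 1%N /\ forall i, 4^-1 <= ell_coef f i ^+ 2.
Proof.
move=> fZ; rewrite /ell_coef /ell_scale; case: (eqVneq n 1%N) => n1.
  by left => i; rewrite divr1; exact: fZ.
have [z zE] := choice (fun i => (intrP (fZ (latu i)) : exists z, _)).
have [/forallP zP|] := boolP [forall i, (2 %| z i)%Z].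
  left => i; rewrite zE; have /dvdzP[q ->] := zP i.
  by rewrite intrM mulfK ?pnatr_eq0// intr_int.
rewrite negb_forall => /existsP[i zi]; right; split=> // j.
(* Since [f(latu i) + f(latu j) = 2 f(latw i j)], one odd [z i] forces all [z j] to be odd, hence
   nonzero. *)
have /intrP[w wE] := fZ (latw i j).
have : z i + z j = w *+ 2.
  apply: (@intr_inj R); rewrite rmorphD rmorphMn/= -wE -!zE -dualMn latw_double.
  by rewrite dualD.
move=> zw; have : z j != 0 by apply: contraNneq zi => zj; apply/dvdzP; exists w; lia.
rewrite zE expr_div_n => zj.
have : 1 <= (z j)%:~R ^+ 2 :> R.
  by rewrite -rmorphXn/= ler1z; move: zj; rewrite expr2; nia.
by rewrite (_ : 2 ^+ 2 = 4 :> R); [lra|ring].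
Qed.

Lemma int_sqr_ge1 (x : R) : x \is a Num.int -> x != 0 -> 1 <= x ^+ 2.
Proof.
move=> /intrP[z ->]; rewrite intr_eq0 => z0.
by rewrite -rmorphXn/= ler1z expr2; move: z0; nia.
Qed.

Lemma ell_coef_neq0 f : f <> 0 -> exists i, ell_coef f i != 0.
Proof.
move=> f0; apply/existsP; rewrite -negb_forall; apply/negP => /forallP c0.
by apply: f0; rewrite [f]dual_decomp big1// => i _; rewrite (eqP (c0 i) : _ / _ = 0) scale0r.
Qed.

Lemma std_dot_half f : (forall i, 4^-1 <= ell_coef f i ^+ 2) -> n%:R / 4 <= std_dot f f.
Proof.
move=> cf; rewrite std_dotE.
have -> : n%:R / 4 = \sum_(i < n) 4^-1 :> R.
  by rewrite sumr_const card_ord mulr_natl.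
exact: ler_sum.
Qed.

Lemma std_dot_ge1 f : n <> 2%N -> n <> 3%N -> dualZ f -> f <> 0 -> 1 <= std_dot f f.
Proof.
move=> n2 n3 /dualZ_coef fZ /ell_coef_neq0[i ci]; case: fZ => [fZ|[n1 fZ]].
  rewrite std_dotE (bigD1 i)//= -[1]addr0 lerD ?int_sqr_ge1//.
  by apply: sumr_ge0 => j _; exact: sqr_ge0.
have n4 : (4 <= n)%N by move: (ltn_ord i); lia.
by apply: le_trans (std_dot_half fZ); rewrite ler_pdivlMr// mul1r ler_nat.
Qed.

(** Vectors with half-integral coefficients have norm at least [n/4 > 1], and an integral vector of
    norm 1 has a single nonzero coefficient, equal to 1 or -1. *)
Lemma std_dot_eq1 f : n <> 2%N -> n <> 3%N -> n <> 4%N -> dualZ f ->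
  std_dot f f = 1 -> exists i, sq f = sq (l i).
Proof.
move=> n2 n3 n4 fZ Q1.
have /ell_coef_neq0[i ci] : f <> 0.
  move=> f0; move: Q1; rewrite f0 std_dotE big1 => [/esym/eqP|j _].
    by rewrite oner_eq0.
  by rewrite /ell_coef -[_ (latu j)]/0 mul0r expr0n.
case: (dualZ_coef fZ) => [cZ|[n1 cf]]; last first.
  have := std_dot_half cf; rewrite Q1 ler_pdivrMr// mul1r ler_nat.
  by move: (ltn_ord i); lia.
exists i; have ci1 := int_sqr_ge1 (cZ i) ci.
move: Q1; rewrite std_dotE (bigD1 i)//=; set S := \sum_(_ | _) _ => Q1.
have S0 : 0 <= S by apply: sumr_ge0 => j _; exact: sqr_ge0.
have /eqP : S = 0 by lra.
rewrite psumr_eq0 => [/allP/= c0|j _]; last exact: sqr_ge0.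
rewrite [f in LHS]dual_decomp (bigD1 i)//= big1 ?addr0 => [|j ji].
  by rewrite sqZ (_ : _ ^+ 2 = 1) ?scale1r// -/(ell_coef f i); lra.
have := c0 j; rewrite mem_index_enum ji /= sqrf_eq0 => /(_ isT)/eqP.
by rewrite /ell_coef => ->; rewrite scale0r.
Qed.

Lemma std_dot_ell i : std_dot (l i) (l i) = 1.
Proof.
have r0 := ell_scale_neq0 R n.
rewrite std_dotE (bigD1 i)//= big1 ?addr0 => [|j /negPf ji].
  by rewrite /ell_coef ell_latu eqxx mulr1 divff// expr1n.
by rewrite /ell_coef ell_latu eq_sym ji mulr0 mul0r expr0n.
Qed.

End StdDot.

(** * Comparison with the perfect cone decomposition *)

Lemma face_refl (R : realType) (V : lmodType R) (sigma : set V) : face sigma sigma.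
Proof. by exists \0 => //; apply/seteqP; split=> [v|v []]. Qed.

Lemma face_sub (R : realType) (V : lmodType R) (tau sigma : set V) :
  face tau sigma -> tau `<=` sigma.
Proof. by move=> [phi _ ->] v []. Qed.

Section Perfect.
Variables (R : realType) (n : nat).
Local Notation L := (FS_lattice n).
Local Notation l := (@ell R n).
Local Notation sigma := (FS_cone R n).
Local Notation min_cone Q := (cone [set sq m | m in [set m | dualZ m /\ Q m m = 1]]).
Implicit Types Q : {dot (dualR R L) for idfun}.

Lemma perfect_std : n <> 2%N -> n <> 3%N -> perfect_cone (min_cone (@std_dot R n)).
Proof.
move=> n2 n3; exists (@std_dot R n : {dot (dualR R L) for idfun}); last exact: face_refl.
by move=> m; exact: std_dot_ge1.
Qed.

Lemma FS_sub_std : sigma `<=` min_cone (@std_dot R n).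
Proof.
apply: sub_cone => _ [i _ <-]; exists (l i) => //.
by split; [exact: ell_dualZ|exact: std_dot_ell].
Qed.

Lemma FS_perfect : n <> 2%N -> n <> 3%N -> n <> 4%N -> perfect_cone sigma.
Proof.
move=> n2 n3 n4; suff -> : sigma = min_cone (@std_dot R n) by exact: perfect_std.
apply/seteqP; split; first exact: FS_sub_std.
apply: sub_cone => _ [m [mZ m1] <-].
by have [i ->] := std_dot_eq1 n2 n3 n4 mZ m1; exists i.
Qed.

(** Extremality yields a minimal vector [a ell_i] with [a] a nonzero integer; then
    [a^2 Q(ell_i) = 1] with both factors at least 1. *)
Lemma dot_ell_eq1 Q : (forall m, dualZ m -> m <> 0 -> 1 <= Q m m) ->
  sigma `<=` min_cone Q -> forall i, Q (l i) (l i) = 1.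
Proof.
move=> Q1 sQ i; have : sigma (sq (l i)) by apply: mem_cone; exists i.
move=> /sQ/ell_sq_extremal[m [mZ m1] [a a0 mE]].
have [x x1] := ell_eq1 R i.
have aZ : a \is a Num.int by have := mZ x; rewrite mE dual_scaleE x1 mulr1.
have a1 := int_sqr_ge1 aZ a0.
have l1 := Q1 _ (ell_dualZ R i) (@ell_neq0 R n i).
move: m1; rewrite mE dotZl dotZr mulrA -expr2 => m1; nra.
Qed.

Lemma FS_perfect_ge4 Q : (forall m, dualZ m -> m <> 0 -> 1 <= Q m m) ->
  sigma `<=` min_cone Q -> (2 <= n)%N -> (4 <= n)%N.
Proof.
move=> Q1 sQ n2; have n1 : n != 1%N by lia.
have := sum_dot_half (dot_ell_eq1 Q1 sQ) => sumE.
have : \sum_(s : {ffun 'I_n -> bool}) 1 <= 2 ^+ n * (n%:R / 4) :> R.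
  rewrite -sumE; apply: ler_sum => s _; apply: Q1; first exact: half_sum_dualZ.
  exact: (half_sum_neq0 (Ordinal n2)).
rewrite sumr_const card_ffun card_bool card_ord natrX.
by rewrite -[leLHS]mulr1 ler_pM2l ?exprn_gt0// ler_pdivlMr// mul1r ler_nat.
Qed.

(* For n = 4 all the half sums are minimal vectors, and the sum of their squares
   is in the FS cone, so that a face containing it contains these squares. *)
Lemma FS4_not_perfect : n = 4%N -> ~ perfect_cone sigma.
Proof.
move=> n4 [Q Q1 sQ]; have n1 : n != 1%N by lia.
have n0 : (0 < n)%N by lia. have n2 : (1 < n)%N by lia.
have Ql := dot_ell_eq1 Q1 (face_sub sQ).
have h1 (s : {ffun 'I_n -> bool}) : 1 <= Q (half_sum R s) (half_sum R s).
  by apply: Q1; [exact: half_sum_dualZ|exact: (half_sum_neq0 (Ordinal n0))].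
have Qh s : Q (half_sum R s) (half_sum R s) = 1.
  (* The average of [Q] over the half sums is [n/4 = 1], so these nonnegative excesses add up to
     zero. *)
  have : \sum_(s : {ffun 'I_n -> bool}) (Q (half_sum R s) (half_sum R s) - 1) = 0.
    rewrite sumrB sum_dot_half// sumr_const card_ffun card_bool card_ord natrX.
    by rewrite [in n%:R / 4]n4 divff ?pnatr_eq0// mulr1 subrr.
  move=> /eqP; rewrite psumr_eq0 => [/allP/(_ s)|t _]; last by rewrite subr_ge0.
  by rewrite mem_index_enum /= => /(_ isT); rewrite subr_eq0 => /eqP.
case: sQ => phi phi0 sE.
have hQ s : min_cone Q (sq (half_sum R s)).
  by apply: mem_cone; exists (half_sum R s) => //; split; [exact: half_sum_dualZ|].
have phil i : phi (sq (l i)) = 0.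
  have : sigma (sq (l i)) by apply: mem_cone; exists i.
  by rewrite sE => -[].
pose s0 : {ffun 'I_n -> bool} := [ffun=> false].
have : sigma (sq (half_sum R s0)).
  rewrite sE; split; first exact: hQ.
  have := congr1 phi (sum_sq_half R n); rewrite scalarZ !raddf_sum/=.
  rewrite [in RHS]big1 ?mulr0// => /eqP.
  rewrite psumr_eq0 => [/allP/(_ s0)|s _]; last exact/phi0/hQ.
  by rewrite mem_index_enum /= => /(_ isT)/eqP.
(* Every [ell_i^2] vanishes on a pair of distinct [latu], whereas [h^2] does not. *)
move=> /cone_rangeP[c _ /(congr1 (form_ev (latu (Ordinal n0)) (latu (Ordinal n2))))].
rewrite /form_ev symform_lincombE sqE !half_sum_latu big1 => [/eqP|i _].
  by rewrite !mulf_eq0 invr_eq0 pnatr_eq0 (negPf (ell_scale_neq0 R n)) !signr_eq0.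
rewrite sqE !ell_latu; case: eqVneq => [->|_]; last by rewrite mulr0 mul0r mulr0.
by rewrite -val_eqE /= !mulr0.
Qed.

End Perfect.

Theorem theorem6p4 (R : realType) (n : nat) (n_ge1 : (1 <= n)%N) :
  let L := FS_lattice n in
  let sigma := FS_cone R n in
  [/\ [/\ (3 <= n)%N -> basic (@symZ R L) sigma,
          n = 1%N -> basic (@symZ R L) sigma &
          n = 2%N -> simplicial (@symZ R L) sigma /\ ~ basic (@symZ R L) sigma],
      (matroidal sigma <-> n = 1%N) /\
      (forall tau, proper_face tau sigma -> matroidal tau) &
      ((exists tau, @perfect_cone R L tau /\ sigma `<=` tau) <->
         n <> 2%N /\ n <> 3%N) /\
      (perfect_cone sigma <-> [/\ n <> 2%N, n <> 3%N & n <> 4%N])].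
Proof.
move=> L sigma.
(* Both equivalences in the last part use this: [tau] is a face of the cone of minimal vectors of
   [Q], so that this cone contains [sigma]. *)
have ge4 tau : @perfect_cone R L tau -> sigma `<=` tau -> n <> 2%N /\ n <> 3%N.
  move=> [Q Q1 /face_sub tQ] st.
  by have := FS_perfect_ge4 Q1 (subset_trans st tQ); lia.
split; [split|split|split; split].
- exact: FS_basic.
- exact: FS1_basic.
- by move=> n2; split; [exact: FS_simplicial|exact: FS2_not_basic].
- split; last exact: FS1_matroidal.
  by move=> mat; apply: contrapT => n1; apply: (@FS_not_matroidal R n _ mat); lia.
- exact: FS_proper_face_matroidal.
- by move=> [tau [tP]]; exact: ge4.
- by move=> [n2 n3]; eexists; split; [exact: perfect_std|exact: FS_sub_std].
- move=> sP; have [n2 n3] := ge4 _ sP (@subset_refl _ _).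
  by split=> // n4; exact: FS4_not_perfect sP.
- by move=> [n2 n3 n4]; exact: FS_perfect.
Qed.
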